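(* Let $G$, $H$, $J$ be graphs such that $H$ is $J$-decomposable and $\mathrm{Hom}(J,G)$ is non-empty. Fix a $J$-decomposition $(\mathcal F,\mathcal T)$ of $H$. Then \[ t_H(G)\ge \frac{t_J(G)^{|\mathcal F|}}{\prod_{XY\in E(\mathcal T)} t_{H[X\cap Y]}(G)}. \]
   Context: All graphs are finite and simple. For graphs $H,G$, $\mathrm{Hom}(H,G)$ is the set of graph homomorphisms from $H$ to $G$, and $t_H(G)=|\mathrm{Hom}(H,G)|/|V(G)|^{|V(H)|}$ (for the graph with no vertices this equals $1$). A tree decomposition of $H$ is a pair $(\mathcal F,\mathcal T)$, $\mathcal F$ a family of subsets of $V(H)$ and $\mathcal T$ a tree on vertex set $\mathcal F$, such that (1) $\bigcup_{X\in\mathcal F}X=V(H)$; (2) every edge of $H$ lies in some $X\in\mathcal F$; (3) $X\cap Y\subseteq Z$ whenever $Z$ lies on the $\mathcal T$-path from $X$ to $Y$. A $J$-decomposition of $H$ is a tree decomposition $(\mathcal F,\mathcal T)$ such that each induced subgraph $H[X]$, $X\in\mathcal F$, is isomorphic to $J$, and for every pair $X,Y$ adjacent in $\mathcal T$ there is an isomorphism between $H[X]$ and $H[Y]$ fixing $X\cap Y$ pointwise. $H$ is $J$-decomposable if it has a $J$-decomposition. *)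

(* Defs.v *)
From HB Require Import structures.
From mathcomp Require Import all_boot all_order all_algebra.

Set Implicit Arguments.
Unset Strict Implicit.
Unset Printing Implicit Defensive.

Import Order.TTheory GRing.Theory Num.Theory.
Local Open Scope ring_scope.

Record sgraph (V : finType) := SGraph {
  adj : rel V;
  adj_sym : symmetric adj;
  adj_irr : irreflexive adj
}.

Definition edges (V : finType) (G : sgraph V) : {set {set V}} :=
  [set [set x; y] | x in V, y in V & adj G x y].

Definition induced_adj (V : finType) (G : sgraph V) (X : {set V}) :
  rel {x : V | x \in X} := fun x y => adj G (sval x) (sval y).

Lemma induced_sym (V : finType) (G : sgraph V) (X : {set V}) :
  symmetric (@induced_adj V G X).
Proof. by move=> x y; apply: adj_sym. Qed.

Lemma induced_irr (V : finType) (G : sgraph V) (X : {set V}) :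
  irreflexive (@induced_adj V G X).
Proof. by move=> x; apply: adj_irr. Qed.

Definition induced (V : finType) (G : sgraph V) (X : {set V}) :
  sgraph {x : V | x \in X} := SGraph (@induced_sym V G X) (@induced_irr V G X).

Definition graph_homs (V W : finType) (H : sgraph V) (G : sgraph W) :
  {set {ffun V -> W}} :=
  [set f : {ffun V -> W} |
    [forall x, forall y, adj H x y ==> adj G (f x) (f y)]].

(* When V is empty this is 1, even if W is empty as well: 0 ^+ 0 = 1. *)
Definition hom_density (V W : finType) (H : sgraph V) (G : sgraph W) : rat :=
  #|graph_homs H G|%:R / #|W|%:R ^+ #|V|.

Definition graph_iso (V W : finType) (H : sgraph V) (G : sgraph W)
  (f : V -> W) : Prop :=
  bijective f /\ forall x y, adj G (f x) (f y) = adj H x y.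

Definition isomorphic (V W : finType) (H : sgraph V) (G : sgraph W) : Prop :=
  exists f : V -> W, graph_iso H G f.

Definition connected_graph (V : finType) (G : sgraph V) : Prop :=
  (0 < #|V|)%N /\ forall x y, connect (adj G) x y.

(* The bound on the size excludes the degenerate [ucycle]s: the empty one and
   [:: x; y] for an edge xy. *)
Definition acyclic (V : finType) (G : sgraph V) : Prop :=
  forall c : seq V, (2 < size c)%N -> ~ ucycle (adj G) c.

Definition is_tree (V : finType) (G : sgraph V) : Prop :=
  connected_graph G /\ acyclic G.

Definition on_path (V : finType) (G : sgraph V) (x y z : V) : Prop :=
  exists p : seq V,
    [/\ path (adj G) x p, uniq (x :: p), last x p = y & z \in x :: p].

Definition tree_decomposition (V : finType) (H : sgraph V)
  (F : {set {set V}}) (T : sgraph {X : {set V} | X \in F}) : Prop :=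
  [/\ is_tree T,
      \bigcup_(X in F) X = [set: V],
      forall x y, adj H x y -> exists2 X, X \in F & (x \in X) && (y \in X)
    & forall X Y Z, on_path T X Y Z -> sval X :&: sval Y \subset sval Z].

Definition J_decomposition (U V : finType) (J : sgraph U) (H : sgraph V)
  (F : {set {set V}}) (T : sgraph {X : {set V} | X \in F}) : Prop :=
  [/\ tree_decomposition H T,
      forall X, X \in F -> isomorphic (induced H X) J
    & forall X Y, adj T X Y ->
        exists2 f : {x : V | x \in sval X} -> {y : V | y \in sval Y},
          graph_iso (induced H (sval X)) (induced H (sval Y)) f
        & forall x, sval x \in sval X :&: sval Y -> sval (f x) = sval x].

(* For an edge e = {X, Y} of T this is X :&: Y. *)
Definition edge_cap (V : finType) (F : {set {set V}})
  (e : {set {X : {set V} | X \in F}}) : {set V} :=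
  \bigcap_(X in e) sval X.

(* Main.v *)
(* The entropy argument, with Jensen's inequality replaced by Hoelder's. For an
   edge e = XY of T let d_e(h) be the density of the extensions of h from X :&: Y
   to a homomorphism of H[X]; the isomorphism fixing X :&: Y shows that Y gives
   the same value. For h uniform among the maps from V(H) to V(G), the Markov
   weight w = 1_(h is a homomorphism) / prod_e d_e makes each bag distributed as a
   uniform homomorphism, as one sees by growing a subtree of T from that bag.
   Hence E[w] = t_J, E[w / d_e] <= t_(H[X :&: Y]) and E[w prod_e d_e] = t_H, and
   Hoelder's inequality for the probability density w / t_J gives
   1 <= (t_H / t_J) prod_e (t_(H[X :&: Y]) / t_J), where |E(T)| = |F| - 1. *)
Require Import Defs.
From HB Require Import structures.
From mathcomp Require Import all_boot all_order all_algebra.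

Set Implicit Arguments.
Unset Strict Implicit.
Unset Printing Implicit Defensive.

Import Order.TTheory GRing.Theory Num.Theory.
Local Open Scope ring_scope.

(** * Uniform averages over finite sets, and Hoelder's inequality *)

Section Averages.
Variable R : numFieldType.

Definition avg (Omega : finType) (f : Omega -> R) : R :=
  (\sum_x f x) / #|Omega|%:R.

Lemma eq_avg (Omega : finType) (f g : Omega -> R) : f =1 g -> avg f = avg g.
Proof. by move=> fg; rewrite /avg (eq_bigr g). Qed.

Lemma card_inhabited (Omega : finType) (x : Omega) : (#|Omega|%:R : R) != 0.
Proof. by rewrite pnatr_eq0 -lt0n; apply/card_gt0P; exists x. Qed.

Lemma avg_cst (Omega : finType) (x : Omega) (c : R) :
  avg (fun _ : Omega => c) = c.
Proof.
by rewrite /avg sumr_const -[c *+ _]mulr_natr mulfK ?(card_inhabited x).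
Qed.

Lemma avgMl (Omega : finType) (c : R) (f : Omega -> R) :
  avg (fun x => c * f x) = c * avg f.
Proof. by rewrite /avg -mulr_sumr mulrA. Qed.

Lemma avg_sum (Omega I : finType) (P : pred I) (F : I -> Omega -> R) :
  avg (fun x => \sum_(i | P i) F i x) = \sum_(i | P i) avg (F i).
Proof. by rewrite /avg exchange_big -mulr_suml. Qed.

Lemma avgD (Omega : finType) (f g : Omega -> R) :
  avg (fun x => f x + g x) = avg f + avg g.
Proof. by rewrite /avg big_split mulrDl. Qed.

Lemma ler_avg (Omega : finType) (f g : Omega -> R) :
  (forall x, f x <= g x) -> avg f <= avg g.
Proof. by move=> fg; rewrite ler_wpM2r ?invr_ge0 ?ler_sum. Qed.

Lemma avg_ge0 (Omega : finType) (f : Omega -> R) :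
  (forall x, 0 <= f x) -> 0 <= avg f.
Proof. by move=> f0; rewrite mulr_ge0 ?invr_ge0 ?sumr_ge0. Qed.

Lemma avg_gt0 (Omega : finType) (f : Omega -> R) x :
  (forall y, 0 <= f y) -> 0 < f x -> 0 < avg f.
Proof.
move=> f0 fx; rewrite mulr_gt0 ?invr_gt0 ?ltr0n //; last first.
  by apply/card_gt0P; exists x.
by rewrite (bigD1 x) //= ltr_pwDl ?sumr_ge0.
Qed.

(** Restricting a uniform random map along an injection gives a uniform random map, because all
    fibres of the restriction have the same size. The map [h] excludes an empty space of maps, whose
    average would be 0 by default. *)
Lemma avg_comp_inj (U V W : finType) (i : U -> V) (h : {ffun V -> W})
    (f : {ffun U -> W} -> R) :
  injective i ->
  avg (fun g : {ffun V -> W} => f [ffun u => g (i u)]) = avg f.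
Proof.
move=> i_inj.
pose m := (#|W| ^ #|[predC codom i]|)%N.
have fib u : #|[pred g : {ffun V -> W} | [ffun x => g (i x)] == u]| = m.
  (* The fibre over [u] is a product set: one allowed value at each point of the image of [i], all
     of [W] elsewhere. *)
  pose B v : pred W := fun w => [forall x, (i x == v) ==> (w == u x)].
  rewrite (@eq_card _ _ (family B)); last first.
    move=> g; rewrite !inE; apply/eqP/familyP => [gu v|Bg].
      by apply/forallP => x; apply/implyP => /eqP <-; rewrite -gu ffunE.
    apply/ffunP => x; rewrite ffunE.
    by have /forallP/(_ x) := Bg (i x); rewrite eqxx => /eqP.
  rewrite card_family /m foldrE big_map big_enum /=.
  rewrite (bigID (mem (codom i))) /= big1 ?mul1n; last first.
    move=> _ /codomP [x ->]; apply: (@eq_card1 _ (u x)) => w.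
    rewrite !inE; apply/forallP/eqP => [/(_ x)|-> y].
      by rewrite eqxx => /eqP.
    by apply/implyP => /eqP/i_inj ->.
  rewrite -prod_nat_const; apply: eq_bigr => v vi.
  apply: eq_card => w; rewrite !inE; apply/forallP => x.
  by apply/implyP => /eqP xv; move: vi; rewrite -xv /= codom_f.
have cardV : (#|{ffun V -> W}| = m * #|{ffun U -> W}|)%N.
  by rewrite /m !card_ffun -expnD -(card_codom i_inj) addnC cardC.
have := card_inhabited h; rewrite cardV natrM mulf_eq0 negb_or => /andP[m0 U0].
rewrite /avg cardV natrM /=.
rewrite (partition_big (fun g : {ffun V -> W} => [ffun u => g (i u)]) predT) //=.
rewrite (eq_bigr (fun u => m%:R * f u)); last first.
  move=> u _; rewrite (eq_bigr (fun _ => f u)) => [|g /eqP -> //].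
  by rewrite sumr_const fib mulr_natl.
by rewrite -mulr_sumr -mulf_div divff // mul1r.
Qed.

(* Hoelder's inequality for the [#|A|.+1] functions [\prod_(e in A) D e] and
   [1 / D e], whose product is 1. *)
Lemma hoelder_inv (Omega I : finType) (A : {set I}) (p : Omega -> R)
    (D : I -> Omega -> R) :
  (forall x, 0 <= p x) -> avg p = 1 ->
  (forall x e, p x != 0 -> e \in A -> 0 < D e x) ->
  1 <= avg (fun x => p x * \prod_(e in A) D e x) *
       \prod_(e in A) avg (fun x => p x / D e x).
Proof.
move=> p0 p1 Dpos.
(* [None] indexes the product and [Some e] the inverse of [D e], so that all the functions form a
   single family. *)
pose a (o : option I) x := if o is Some e then (D e x)^-1 else \prod_(e in A) D e x.
pose B : {set option I} := None |: Some @: A.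
have NA : None \notin Some @: A by apply/imsetP => -[].
have bigB (F : option I -> R) : \prod_(o in B) F o = F None * \prod_(e in A) F (Some e).
  by rewrite big_setU1 //= big_imset //= => x y _ _ [].
have bigsB (F : option I -> R) : \sum_(o in B) F o = F None + \sum_(e in A) F (Some e).
  by rewrite big_setU1 //= big_imset //= => x y _ _ [].
have [x0 px0] : exists x0, p x0 != 0.
  apply/existsP; apply: contra_eqT p1 => /existsPn p1.
  rewrite (eq_avg (g := fun=> 0)); last by move=> x; apply/eqP/negPn.
  by rewrite /avg big1 // mul0r eq_sym oner_neq0.
have apos x o : p x != 0 -> o \in B -> 0 < a o x.
  move=> px; rewrite !inE => /orP[/eqP->|/imsetP[e eA ->]] /=.
    by apply: prodr_gt0 => e; apply: Dpos.
  by rewrite invr_gt0 Dpos.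
pose m o := avg (fun x => p x * a o x).
have mpos o : o \in B -> 0 < m o.
  move=> oB; apply: (avg_gt0 (x := x0)) => [x|].
    have [->|px] := eqVneq (p x) 0; first by rewrite mul0r.
    by rewrite mulr_ge0 ?p0 // ltW ?apos.
  by rewrite mulr_gt0 ?apos // lt_def px0 p0.
rewrite -[X in X * _]/(m None) -[X in _ * X]/(\prod_(e in A) m (Some e)) -bigB.
set M := \prod_(o in B) m o.
have Mpos : 0 < M by apply: prodr_gt0.
have prod_a x : p x != 0 -> \prod_(o in B) (a o x / m o) = M^-1.
  move=> px; rewrite big_split /= prodfV bigB /= -/M.
  rewrite -big_split /= big1 ?mul1r // => e eA.
  by rewrite mulfV // gt_eqF // Dpos.
have nB : (0 < #|B|)%N by apply/card_gt0P; exists None; rewrite !inE eqxx.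
have nBR : (0 : R) < #|B|%:R by rewrite ltr0n.
(* Suppose [M < 1]. The mean [mu] of the normalised functions [a o / m o] has [p]-average 1, but
   their product is [M^-1 > 1] on the support of [p], so AM-GM forces [mu > 1] there. *)
rewrite real_leNgt ?ger0_real ?ltW //; apply/negP => M1.
pose mu x := (\sum_(o in B) a o x / m o) / #|B|%:R.
have avg_mu : avg (fun x => p x * mu x) = 1.
  rewrite (eq_avg (g := fun x =>
    \sum_(o in B) (m o * #|B|%:R)^-1 * (p x * a o x))); last first.
    move=> x; rewrite /mu mulr_suml mulr_sumr; apply: eq_bigr => o _.
    by rewrite [RHS]mulrC !mulrA -[LHS]mulrA -invfM.
  rewrite avg_sum (eq_bigr (fun=> #|B|%:R^-1)) => [|o oB].
    by rewrite sumr_const -[_ *+ _]mulr_natr mulVf // gt_eqF.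
  by rewrite avgMl -/(m o) invfM mulrAC mulVf ?mul1r // gt_eqF ?mpos.
have mu_gt1 x : p x != 0 -> 1 < mu x.
  move=> px; have b0 : {in B, forall o, 0 <= a o x / m o}.
    by move=> o oB; rewrite divr_ge0 ?ltW ?apos ?mpos.
  have mu0 : 0 <= mu x by rewrite divr_ge0 ?sumr_ge0 ?ltW.
  have [+ _] := leif_AGM b0; rewrite prod_a // => /(lt_le_trans _) lt_mu.
  rewrite -(@expr_gt1 _ #|B|) //; apply: lt_mu; rewrite invf_gt1 //.
have : 0 < avg (fun x => p x * mu x + -1 * p x).
  have E x : p x * mu x + -1 * p x = p x * (mu x - 1).
    by rewrite mulN1r mulrBr mulr1.
  apply: (avg_gt0 (x := x0)) => [x|]; rewrite E.
    have [->|px] := eqVneq (p x) 0; first by rewrite mul0r.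
    by rewrite mulr_ge0 ?p0 // subr_ge0 ltW ?mu_gt1.
  by rewrite mulr_gt0 ?subr_gt0 ?mu_gt1 // lt_def px0 p0.
by rewrite avgD avgMl avg_mu p1 mulr1 subrr ltxx.
Qed.
End Averages.

(** * Conditional expectation on the space of maps *)

Section ConditionalAverages.
Variables (R : numFieldType) (V W : finType).
Implicit Types (A B : {set V}) (h g : {ffun V -> W}) (f : {ffun V -> W} -> R).

Definition splice A h g : {ffun V -> W} :=
  [ffun x => if x \in A then h x else g x].

(* The conditional expectation, for the uniform measure on [{ffun V -> W}],
   given the coordinates in [A]. *)
Definition cond_avg A f h : R := avg (fun g => f (splice A h g)).

Definition depends_on A f : Prop :=
  forall h h', {in A, h =1 h'} -> f h = f h'.

Lemma depends_onW A B f : A \subset B -> depends_on A f -> depends_on B f.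
Proof. by move=> /subsetP AB fA h h' hh'; apply: fA => x /AB /hh'. Qed.

Lemma depends_onM A f f' :
  depends_on A f -> depends_on A f' -> depends_on A (fun h => f h * f' h).
Proof. by move=> fA fA' h h' hh'; rewrite (fA h h') ?(fA' h h'). Qed.

Lemma depends_on_prod (I : finType) (P : pred I) A (F : I -> {ffun V -> W} -> R) :
  (forall i, P i -> depends_on A (F i)) ->
  depends_on A (fun h => \prod_(i | P i) F i h).
Proof. by move=> FA h h' hh'; apply: eq_bigr => i Pi; apply: FA. Qed.

Lemma depends_on_inv A f : depends_on A f -> depends_on A (fun h => (f h)^-1).
Proof. by move=> fA h h' hh'; rewrite (fA h h'). Qed.

Lemma depends_on_cond_avg A f : depends_on A (cond_avg A f).
Proof.
move=> h h' hh'; apply: eq_avg => g; congr f.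
by apply/ffunP => x; rewrite !ffunE; case: ifP => // /hh'.
Qed.

Lemma eq_cond_avg A f f' : f =1 f' -> cond_avg A f =1 cond_avg A f'.
Proof. by move=> ff' h; apply: eq_avg => g; rewrite ff'. Qed.

Lemma cond_avgMl A f f' h :
  depends_on A f -> cond_avg A (fun g => f g * f' g) h = f h * cond_avg A f' h.
Proof.
move=> fA; rewrite -avgMl; apply: eq_avg => g; congr (_ * _).
by apply: fA => x xA; rewrite ffunE xA.
Qed.

Lemma cond_avg_id A f h : depends_on A f -> cond_avg A f h = f h.
Proof.
move=> fA; rewrite -[RHS](avg_cst h (f h)); apply: eq_avg => g.
by apply: fA => x xA; rewrite ffunE xA.
Qed.

(** Coordinates outside [B] do not influence [f], so fixing them or resampling them makes no
    difference. *)
Lemma cond_avg_local A B f h :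
  depends_on B f -> cond_avg A f h = cond_avg (A :&: B) f h.
Proof.
by move=> fB; apply: eq_avg => g; apply: fB => x xB; rewrite !ffunE inE xB andbT.
Qed.

(* The map (g, g') |-> (splice B g g', splice B g' g) is an involution. *)
Lemma avg_cond_avg B f : avg (cond_avg B f) = avg f.
Proof.
have [h _|W0] := pickP {: {ffun V -> W}}; last first.
  by rewrite /avg !big1 // => h; have := W0 h; rewrite inE.
pose s (q : {ffun V -> W} * {ffun V -> W}) := (splice B q.1 q.2, splice B q.2 q.1).
have sK : involutive s.
  by move=> [g g']; congr (_, _); apply/ffunP => x; rewrite !ffunE /=; case: (x \in B).
rewrite /cond_avg /avg -mulr_suml pair_big /= (reindex_inj (inv_inj sK)) /=.
rewrite (eq_bigr (fun q : {ffun V -> W} * {ffun V -> W} => f q.1)); last first.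
  by move=> [g g'] _; congr f; apply/ffunP => x; rewrite !ffunE /=; case: (x \in B).
rewrite -(pair_big xpredT xpredT (fun g _ => f g)) /=.
rewrite (eq_bigr (fun g => f g * #|{ffun V -> W}|%:R)); last first.
  by move=> g _; rewrite sumr_const mulr_natr.
by rewrite -mulr_suml mulfK // (card_inhabited R h).
Qed.

(** Both sides evaluate [f] at the same map: [h] on [A], one random map on the rest of [B], a second
    one outside [B]. *)
Lemma cond_avg_tower A B f h :
  A \subset B -> cond_avg A (cond_avg B f) h = cond_avg A f h.
Proof.
move=> /subsetP AB; rewrite -[RHS](avg_cond_avg B); apply: eq_avg => g.
apply: eq_avg => g'; congr f; apply/ffunP => x; rewrite !ffunE.
by case: (boolP (x \in A)) => // /AB ->.
Qed.

Lemma cond_avg_ge0 A f h : (forall g, 0 <= f g) -> 0 <= cond_avg A f h.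
Proof. by move=> f0; apply: avg_ge0. Qed.

Lemma cond_avg_gt0 A f h : (forall g, 0 <= f g) -> 0 < f h -> 0 < cond_avg A f h.
Proof.
move=> f0 fh; apply: (avg_gt0 (x := h)) => //.
by rewrite [splice _ _ _](_ : _ = h) //; apply/ffunP => x; rewrite ffunE if_same.
Qed.

End ConditionalAverages.

(** * Growing a tree vertex by vertex *)

Section Trees.
Variables (V : finType) (T : sgraph V).
Implicit Types (x y z : V) (S : {set V}).

Definition adj_in S : rel V := [rel x y | [&& adj T x y, x \in S & y \in S]].

Definition connected_in S : Prop :=
  forall x y, x \in S -> y \in S -> connect (adj_in S) x y.

Definition edges_in S : {set {set V}} := [set e in edges T | e \subset S].

Lemma edgesP (e : {set V}) :
  reflect (exists2 xy, adj T xy.1 xy.2 & e = [set xy.1; xy.2]) (e \in edges T).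
Proof.
apply: (iffP imset2P) => [[x y _]|[[x y] /= Txy ->]].
  by rewrite inE => /andP[_ Txy] ->; exists (x, y).
by exists x y; rewrite // inE Txy.
Qed.

Lemma adj_in_sym S : connect_sym (adj_in S).
Proof.
apply: sym_connect_sym => x y; rewrite /adj_in /= adj_sym; congr (_ && _); exact: andbC.
Qed.

Lemma connected_in1 r : connected_in [set r].
Proof. by move=> x y /set1P-> /set1P->. Qed.

Lemma connected_inU1 S y z :
  connected_in S -> y \in S -> adj T y z -> connected_in (z |: S).
Proof.
move=> cS yS Tyz.
suff cy x : x \in z |: S -> connect (adj_in (z |: S)) y x.
  move=> u v /cy yu /cy; apply: connect_trans; by rewrite adj_in_sym.
case/setU1P => [->|xS].
  by apply: connect1; rewrite /adj_in /= Tyz !inE yS eqxx orbT.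
apply: connect_sub (cS _ _ yS xS) => u v /and3P[uv uS vS].
by apply: connect1; rewrite /adj_in /= uv !inE uS vS !orbT.
Qed.

Lemma connected_in_path S x y :
  connected_in S -> x \in S -> y \in S ->
  exists p, [/\ path (adj T) x p, uniq (x :: p), last x p = y & {subset x :: p <= S}].
Proof.
move=> cS xS yS; have /connectP[p xp ->] := cS _ _ xS yS.
case/shortenP: xp => q xq uq _; exists q; split=> //.
  by apply: sub_path xq => u v /and3P[].
suff: all (mem S) q by move/allP=> Sq u /predU1P[->//|/Sq].
by elim: q x xq {uq xS} => //= u q IH x /andP[/and3P[_ _ ->] /IH].
Qed.

(** Induction on the number of vertices not yet reached: in a connected graph some edge leaves every
    proper subset containing [r]. *)
Lemma tree_ind_growing (P : {set V} -> Prop) r :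
  (forall x y, connect (adj T) x y) ->
  P [set r] ->
  (forall S y z, r \in S -> connected_in S -> y \in S -> z \notin S -> adj T y z ->
     P S -> P (z |: S)) ->
  P [set: V].
Proof.
move=> cT P1 PU.
suff grow n S : (#|~: S| <= n)%N -> r \in S -> connected_in S -> P S -> P setT.
  by apply: (grow _ _ (leqnn _) _ (@connected_in1 r) P1); rewrite set11.
elim: n S => [|n IH] S.
  by rewrite leqn0 cards_eq0 => /eqP S0 _ _; rewrite -[S]setCK S0 setC0.
have [<- //|] := eqVneq S setT; rewrite -subTset => /subsetPn[z _ zS] Sn rS cS PS.
have /exists_inP[y yS /exists_inP[u + Tyu]] :
    [exists y in S, exists u in ~: S, adj T y u].
  (* If no edge left [S], then [S] would be closed under adjacency and would contain everything
     connected to [r], in particular [z]. *)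
  apply: contraNT zS => /exists_inPn Sclosed.
  suff clS : closed (adj T) S by rewrite -(closed_connect clS (cT r z)).
  apply: intro_closed; first exact/sym_connect_sym/adj_sym.
  move=> a b Tab aS; apply: contraNT (Sclosed a aS) => bS.
  by apply/exists_inP; exists b; rewrite ?inE.
rewrite inE => uS.
apply: (IH (u |: S)).
- rewrite -ltnS; apply: leq_trans Sn; apply: proper_card.
  rewrite properE setCS subsetUr; apply/subsetPn; exists u; rewrite !inE ?eqxx //.
- by rewrite !inE rS orbT.
- exact: connected_inU1 Tyu.
- exact: PU Tyu PS.
Qed.

(** Otherwise a simple path from [x] to [y] inside [S] would close up through [z] to a cycle of
    length at least 3. *)
Lemma acyclic_neighbor_uniq S x y z :
  acyclic T -> connected_in S -> x \in S -> y \in S -> z \notin S ->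
  adj T x z -> adj T y z -> x = y.
Proof.
move=> acT cS xS yS zS Txz Tyz.
have [p [xp up py pS]] := connected_in_path cS xS yS.
case: p => [|u p] in xp up py pS *; first exact: py.
case: (acT [:: z, x, u & p]) => //; apply/andP; split; last first.
  by rewrite cons_uniq up andbT; apply: contra zS; apply: pS.
change (adj T z x && path (adj T) x (rcons (u :: p) z)).
by rewrite rcons_path xp py Tyz adj_sym Txz.
Qed.

(** Prefixing [z] to a simple path inside [S] keeps it simple. This brings the third axiom of a tree
    decomposition to bear on a newly attached bag [z]. *)
Lemma on_path_neighbor S x y z :
  connected_in S -> x \in S -> y \in S -> z \notin S -> adj T y z -> on_path T z x y.
Proof.
move=> cS xS yS zS Tyz; have [p [yp up px pS]] := connected_in_path cS yS xS.
exists (y :: p); split; rewrite ?inE ?eqxx ?orbT //.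
  by rewrite /= adj_sym Tyz.
by rewrite cons_uniq up andbT; apply: contra zS; apply: pS.
Qed.

Lemma edges_in1 r : edges_in [set r] = set0.
Proof.
apply/setP => e; rewrite !inE; apply/andP => -[/edgesP[[x y] /= Txy ->]].
rewrite subUset !sub1set !inE => /andP[/eqP xr /eqP yr].
by rewrite xr yr adj_irr in Txy.
Qed.

Lemma edges_inT : edges_in setT = edges T.
Proof. by apply/setP => e; rewrite inE subsetT andbT. Qed.

Lemma notin_edges_in S y z : z \notin S -> [set y; z] \notin edges_in S.
Proof. by move=> zS; rewrite inE subUset !sub1set (negPf zS) !andbF. Qed.

(** Since [y] is the only neighbour of [z] in [S], a growth step creates exactly one edge. *)
Lemma edges_inU1 S y z :
  acyclic T -> connected_in S -> y \in S -> z \notin S -> adj T y z ->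
  edges_in (z |: S) = [set y; z] |: edges_in S.
Proof.
move=> acT cS yS zS Tyz; apply/setP => e; rewrite !inE; apply/andP/orP.
  case=> /edgesP[[a b] /= Tab ->].
  rewrite subUset !sub1set !inE => /andP[/predU1P[az|aS] /predU1P[bz|bS]].
  - by rewrite az bz adj_irr in Tab.
  - left; rewrite az setUC (acyclic_neighbor_uniq acT cS yS bS zS) //.
    by rewrite -az adj_sym.
  - by left; rewrite bz (acyclic_neighbor_uniq acT cS yS aS zS) // -bz.
  - by right; rewrite subUset !sub1set aS bS !andbT; apply/edgesP; exists (a, b).
case=> [/eqP ->|/andP[eT eS]]; split=> //.
- by apply/edgesP; exists (y, z).
- by rewrite subUset !sub1set !inE yS eqxx orbT.
- exact: subset_trans eS (subsetUr _ _).
Qed.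

Lemma card_tree_edges : is_tree T -> #|edges T|.+1 = #|V|.
Proof.
move=> [[/card_gt0P[r _] cT] acT]; rewrite -cardsT -edges_inT.
apply: (tree_ind_growing (P := fun S => #|edges_in S|.+1 = #|S|) (r := r) cT).
  by rewrite edges_in1 cards0 cards1.
move=> S y z _ cS yS zS Tyz IH.
by rewrite (edges_inU1 acT cS yS zS Tyz) !cardsU1 notin_edges_in // zS !add1n IH.
Qed.

End Trees.

(** * Homomorphism densities as averages of indicators *)

Lemma hom_density_avg (V W : finType) (H : sgraph V) (G : sgraph W) :
  hom_density H G = avg (fun h => (h \in graph_homs H G)%:R).
Proof. by rewrite /avg -natr_sum -big_mkcond sum1_card card_ffun natrX. Qed.

Section HomIndicator.
Variables (V W : finType) (H : sgraph V) (G : sgraph W).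
Implicit Types (A B C X Y : {set V}) (h g : {ffun V -> W}).

(** Stated for maps on all of [V], so that the indicators of all bags live on one probability
    space. *)
Definition hom_on A h : bool :=
  [forall x in A, forall y in A, adj H x y ==> adj G (h x) (h y)].

Definition hom_ind A h : rat := (hom_on A h)%:R.

Lemma hom_onP A h :
  reflect (forall x y, x \in A -> y \in A -> adj H x y -> adj G (h x) (h y))
          (hom_on A h).
Proof.
apply: (iffP forall_inP) => [hA x y xA yA|hA x xA].
  by move/forall_inP/(_ y yA)/implyP: (hA x xA).
by apply/forall_inP => y yA; apply/implyP; apply: hA.
Qed.

Lemma hom_ind_ge0 A h : 0 <= hom_ind A h.
Proof. exact: ler0n. Qed.

Lemma depends_on_hom_ind A : depends_on A (hom_ind A).
Proof.
move=> h h' hh'; congr (nat_of_bool _)%:R; apply/hom_onP/hom_onP => hA x y xA yA.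
  by rewrite -!hh' //; apply: hA.
by rewrite !hh' //; apply: hA.
Qed.

Lemma hom_onS A B h : A \subset B -> hom_on B h -> hom_on A h.
Proof.
by move=> /subsetP AB /hom_onP hB; apply/hom_onP => x y /AB xB /AB; apply: hB.
Qed.

(** Here [i] identifies [K] with the subgraph induced on [A]. Taking for [i] an inclusion, a copy of
    [J] or an isomorphism of bags gives the uses below. *)
Lemma hom_on_embedding (U : finType) (K : sgraph U) (i : U -> V) A h :
  (forall v, reflect (exists u, v = i u) (v \in A)) ->
  (forall u u', adj H (i u) (i u') = adj K u u') ->
  hom_on A h = ([ffun u => h (i u)] \in graph_homs K G).
Proof.
move=> iA iadj; rewrite inE; apply/hom_onP/forallP => [hA u|hK].
  apply/forallP => u'; apply/implyP; rewrite !ffunE -iadj.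
  by apply: hA; apply/iA; [exists u|exists u'].
move=> x y /iA[u ->] /iA[u' ->]; rewrite iadj.
by have /forallP/(_ u')/implyP := hK u; rewrite !ffunE.
Qed.

Lemma avg_hom_ind (U : finType) (K : sgraph U) (i : U -> V) A h :
  injective i ->
  (forall v, reflect (exists u, v = i u) (v \in A)) ->
  (forall u u', adj H (i u) (i u') = adj K u u') ->
  avg (hom_ind A) = hom_density K G.
Proof.
move=> i_inj iA iadj.
rewrite hom_density_avg -(avg_comp_inj h _ i_inj); apply: eq_avg => g.
by rewrite /hom_ind (hom_on_embedding _ iA iadj).
Qed.

Lemma mem_sval A v : reflect (exists u : {x | x \in A}, v = sval u) (v \in A).
Proof.
by apply: (iffP idP) => [vA|[u ->]]; [exists (exist _ v vA)|apply: valP].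
Qed.

Lemma avg_hom_ind_induced A h : avg (hom_ind A) = hom_density (induced H A) G.
Proof. exact: avg_hom_ind h val_inj (@mem_sval A) _. Qed.

Lemma avg_hom_ind_isomorphic (U : finType) (J : sgraph U) A h :
  isomorphic (induced H A) J -> avg (hom_ind A) = hom_density J G.
Proof.
move=> [f [[f' fK f'K] fadj]]; apply: (@avg_hom_ind _ _ (sval \o f')) => //.
- exact: inj_comp val_inj (can_inj f'K).
- move=> v; apply: (iffP (mem_sval A v)) => [[u ->]|[u ->]].
    by exists (f u); rewrite /= fK.
  by exists (f' u).
- by move=> u u'; rewrite -{2}(f'K u) -{2}(f'K u') fadj.
Qed.

(** Both sides are the same average over maps [k] on [X] whose values on the separator are
    overwritten by those of [h]; for [Y] the maps are pulled back along [f]. *)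
Lemma cond_avg_hom_ind_iso X Y (f : {x | x \in X} -> {y | y \in Y}) h :
  graph_iso (induced H X) (induced H Y) f ->
  (forall x, sval x \in X :&: Y -> sval (f x) = sval x) ->
  cond_avg (X :&: Y) (hom_ind X) h = cond_avg (X :&: Y) (hom_ind Y) h.
Proof.
move=> [[f' fK f'K] fadj] fix_f; set C := X :&: Y.
pose K := induced H X.
pose s (k : {ffun {x | x \in X} -> W}) : {ffun {x | x \in X} -> W} :=
  [ffun u => if sval u \in C then h (sval u) else k u].
have f_inj : injective (fun u => sval (f u)).
  by apply: inj_comp val_inj (can_inj fK).
(* If [f u] lies in [C], then it is a vertex of [X] fixed by [f], and injectivity makes it equal to
   [u]. *)
have fC u : (sval (f u) \in C) = (sval u \in C).
  apply/idP/idP => [fuC|uC]; last by rewrite fix_f.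
  have fuX : sval (f u) \in X by move: fuC; rewrite inE => /andP[].
  pose u' : {x | x \in X} := exist _ (sval (f u)) fuX.
  by have <- : u' = u by apply: f_inj; apply: fix_f.
have fY v : reflect (exists u, v = sval (f u)) (v \in Y).
  apply: (iffP (mem_sval Y v)) => [[u ->]|[u ->]]; last by exists (f u).
  by exists (f' u); rewrite f'K.
transitivity (avg (fun k => (s k \in graph_homs K G)%:R : rat)).
  rewrite -(avg_comp_inj h _ val_inj); apply: eq_avg => g.
  rewrite /hom_ind (hom_on_embedding (K := K) _ (@mem_sval X)) //.
  by congr (nat_of_bool (in_mem _ _))%:R; apply/ffunP => u; rewrite !ffunE.
rewrite -(avg_comp_inj h _ f_inj); apply: eq_avg => g.
rewrite /hom_ind (hom_on_embedding (K := K) _ fY); last exact: fadj.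
congr (nat_of_bool (in_mem _ _))%:R; apply/ffunP => u; rewrite !ffunE fC.
by case: ifP => // uC; rewrite fix_f.
Qed.

Lemma cond_avg_hom_ind_eq0 A B h :
  A \subset B -> ~~ hom_on A h -> cond_avg A (hom_ind B) h = 0.
Proof.
move=> AB hA; rewrite -[RHS](avg_cst h 0); apply: eq_avg => g.
rewrite /hom_ind (negPf (contra (hom_onS AB) _)) //; apply: contra hA.
move=> /hom_onP hA; apply/hom_onP => x y xA yA.
by have := hA x y xA yA; rewrite !ffunE xA yA.
Qed.

End HomIndicator.

(** * The Markov random homomorphism along the tree *)

Section Decomposition.
Variables (VG VH VJ : finType) (G : sgraph VG) (H : sgraph VH) (J : sgraph VJ).
Variables (F : {set {set VH}}) (T : sgraph {X : {set VH} | X \in F}).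
Hypothesis decT : J_decomposition J H T.
Local Notation node := {X : {set VH} | X \in F}.
Implicit Types (X Y Z : node) (S : {set node}) (e : {set node}).
Implicit Types (h g : {ffun VH -> VG}).

(* The density of extensions of [h] from the separator of [e] to a bag of [e]
   (either of the two bags gives the same value). *)
Definition edge_ext e h : rat :=
  if [pick X in e] is Some X then cond_avg (edge_cap e) (hom_ind H G (sval X)) h
  else 1.

(** An inverse of 0 counts as 0; for a [J]-decomposition this happens only where the indicator of an
    end bag already vanishes. *)
Definition tree_weight S h : rat :=
  (\prod_(Z in S) hom_ind H G (sval Z) h) *
  \prod_(e in edges_in T S) (edge_ext e h)^-1.

Lemma edge_cap2 X Y : adj T X Y -> edge_cap [set X; Y] = sval X :&: sval Y.
Proof.
move=> TXY; rewrite /edge_cap big_setU1 ?big_set1 // inE.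
by apply: contraTN TXY => /eqP ->; rewrite adj_irr.
Qed.

(** Whichever end [pick] returns, the isomorphism fixing the separator transfers its value to
    [Y]. *)
Lemma edge_extE X Y h : adj T X Y ->
  edge_ext [set X; Y] h = cond_avg (sval X :&: sval Y) (hom_ind H G (sval Y)) h.
Proof.
move=> TXY; have [_ _ iso_adj] := decT.
rewrite /edge_ext edge_cap2 //; case: pickP => [Z|/(_ X)]; last first.
  by rewrite !inE eqxx.
case/set2P => -> //; have [f fiso ffix] := iso_adj _ _ TXY.
exact: (cond_avg_hom_ind_iso _ h fiso ffix).
Qed.

Lemma edge_ext_ge0 e h : 0 <= edge_ext e h.
Proof.
rewrite /edge_ext; case: pickP => // X _.
by apply: cond_avg_ge0 => g; apply: hom_ind_ge0.
Qed.

Lemma depends_on_edge_ext e : depends_on (edge_cap e) (edge_ext e).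
Proof.
rewrite /edge_ext; case: pickP => [X _|_ h h' //].
exact: depends_on_cond_avg.
Qed.

Lemma edge_ext_gt0 X Y h : adj T X Y -> hom_on H G (sval Y) h ->
  0 < edge_ext [set X; Y] h.
Proof.
move=> TXY hY; rewrite edge_extE //; apply: cond_avg_gt0 => [g|].
  exact: hom_ind_ge0.
by rewrite /hom_ind hY.
Qed.

Lemma depends_on_tree_weight S :
  depends_on (\bigcup_(Z in S) sval Z) (tree_weight S).
Proof.
apply: depends_onM; apply: depends_on_prod.
  move=> Z ZS; apply: depends_onW (@depends_on_hom_ind _ _ H G (sval Z)).
  exact: (bigcup_sup Z).
move=> e; rewrite inE => /andP[/edgesP[[X Y] /= TXY ->]].
rewrite subUset !sub1set => /andP[XS YS]; apply: depends_on_inv.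
apply: depends_onW (@depends_on_edge_ext _); rewrite edge_cap2 //.
exact: subset_trans (subsetIl _ _) (bigcup_sup X _).
Qed.

(* Under the Markov random homomorphism of density [tree_weight S], each bag is
   uniformly distributed among the homomorphisms of that bag. *)
Lemma cond_avg_tree_weight X h :
  cond_avg (sval X) (tree_weight [set: node]) h = hom_ind H G (sval X) h.
Proof.
have [[[[_ cT] acT] _ _ pathT] _ _] := decT.
apply: (tree_ind_growing (T := T) (P := fun S =>
  cond_avg (sval X) (tree_weight S) h = hom_ind H G (sval X) h) (r := X) cT).
  rewrite (eq_cond_avg _ (f' := hom_ind H G (sval X))) => [|g].
    exact/cond_avg_id/depends_on_hom_ind.
  by rewrite /tree_weight edges_in1 big_set0 big_set1 mulr1.
move=> S Y Z XS cS YS ZS TYZ <-.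
have dYZ := edge_extE _ TYZ.
pose VS := \bigcup_(A in S) sval A.
have subVS A : A \in S -> sval A \subset VS by move=> AS; apply: bigcup_sup.
(* The new bag [Z] meets the old ones only in its separator, as [Y] lies on the tree path from [Z]
   to each of them. *)
have VSZ : VS :&: sval Z = sval Y :&: sval Z.
  apply/eqP; rewrite eqEsubset (setSI _ (subVS Y YS)) andbT subsetI subsetIr andbT.
  rewrite /VS big_distrl /=; apply/bigcupsP => A AS; rewrite setIC.
  exact: pathT (on_path_neighbor cS AS YS ZS TYZ).
(* It suffices to average given all coordinates in [VS]: the indicator of [Z] then averages to
   [edge_ext], which cancels the new inverse factor. *)
rewrite -(cond_avg_tower _ _ (subVS _ XS)) -[RHS](cond_avg_tower _ _ (subVS _ XS)).
apply: eq_cond_avg => g.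
rewrite (eq_cond_avg _ (f' := fun g => (tree_weight S g * (edge_ext [set Y; Z] g)^-1)
                                     * hom_ind H G (sval Z) g)); last first.
  move=> g'; rewrite /tree_weight (edges_inU1 acT cS YS ZS TYZ).
  rewrite !big_setU1 ?notin_edges_in //=.
  by rewrite [_^-1 * _]mulrC !mulrA [RHS]mulrC !mulrA.
have dep : depends_on VS (fun g => tree_weight S g * (edge_ext [set Y; Z] g)^-1).
  apply: depends_onM; first exact: depends_on_tree_weight.
  apply/depends_on_inv/(depends_onW _ (@depends_on_edge_ext _)).
  by rewrite edge_cap2 // -VSZ subsetIl.
rewrite (cond_avgMl _ _ dep) (cond_avg_local _ _ (@depends_on_hom_ind _ _ H G _)).
rewrite VSZ -dYZ cond_avg_id; last exact: depends_on_tree_weight.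
(* The cancellation needs a nonzero [edge_ext]; if [g] fails on [Y], the old weight is itself 0. *)
have [hY|hY] := boolP (hom_on H G (sval Y) g).
  by rewrite mulfVK // gt_eqF // setUC edge_ext_gt0 // adj_sym.
by rewrite /tree_weight (bigD1 Y) //= /hom_ind (negPf hY) !mul0r.
Qed.

(** Every edge of [H] lies in some bag, so a violated edge is detected by a bag. *)
Lemma bags_hom h :
  \prod_(Z in [set: node]) hom_ind H G (sval Z) h = (h \in graph_homs H G)%:R.
Proof.
have [[_ _ coverE _] _ _] := decT.
have [hH|hH] := boolP (h \in graph_homs H G).
  rewrite big1 // => Z _; rewrite /hom_ind (_ : hom_on _ _ _ _) //.
  apply/hom_onP => x y _ _; move: hH; rewrite inE.
  by move=> /forallP/(_ x)/forallP/(_ y)/implyP.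
suff [Z hZ] : exists Z : node, ~~ hom_on H G (sval Z) h.
  by rewrite (bigD1 Z) ?inE //= /hom_ind (negPf hZ) mul0r.
apply/existsP; apply: contraNT hH => /existsPn hZ; rewrite inE.
apply/forallP => x; apply/forallP => y; apply/implyP => Hxy.
have [X XF /andP[xX yX]] := coverE _ _ Hxy.
have /negPn/hom_onP := hZ (exist _ X XF : node); exact.
Qed.

(** Averaging given [Y] turns the weight into the indicator of [Y]; averaging that given the
    separator yields [edge_ext] again. *)
Lemma avg_tree_weight_edge e : e \in edges T ->
  avg (fun h => tree_weight [set: node] h / edge_ext e h) <=
  avg (hom_ind H G (edge_cap e)).
Proof.
case/edgesP => -[X Y] /= TXY ->; rewrite edge_cap2 //.
set C := sval X :&: sval Y.
have depC : depends_on C (fun h => (edge_ext [set X; Y] h)^-1).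
  apply: depends_on_inv; rewrite /C -edge_cap2 //; exact: depends_on_edge_ext.
have depY : depends_on (sval Y) (fun h => (edge_ext [set X; Y] h)^-1).
  exact: depends_onW (subsetIr _ _) depC.
rewrite (eq_avg (g := fun h => (edge_ext [set X; Y] h)^-1 * tree_weight setT h));
  last by move=> h; rewrite mulrC.
rewrite -(avg_cond_avg (sval Y)) (eq_avg (fun h => cond_avgMl _ h depY)).
rewrite (eq_avg (g := fun h => (edge_ext [set X; Y] h)^-1 * hom_ind H G (sval Y) h));
  last by move=> h; rewrite cond_avg_tree_weight.
rewrite -(avg_cond_avg C) (eq_avg (fun h => cond_avgMl _ h depC)).
(* The quotient of [edge_ext] by itself is 1 or, by convention, 0; it is 0 when [h] is not a
   homomorphism on [C]. *)
apply: ler_avg => h; rewrite -edge_extE //.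
have [hC|hC] := boolP (hom_on H G C h).
  rewrite /hom_ind hC; have [->|d0] := eqVneq (edge_ext [set X; Y] h) 0.
    by rewrite mulr0.
  by rewrite mulVf.
by rewrite edge_extE // (cond_avg_hom_ind_eq0 _ hC) ?subsetIr // mulr0.
Qed.

End Decomposition.

(** * Hoelder's inequality applied to the normalised tree weight *)

Theorem theorem2p4 (VG VH VJ : finType)
  (G : sgraph VG) (H : sgraph VH) (J : sgraph VJ)
  (F : {set {set VH}}) (T : sgraph {X : {set VH} | X \in F})
  (decT : J_decomposition J H T) (homJG : graph_homs J G != set0) :
  hom_density H G >=
    hom_density J G ^+ #|F| /
      \prod_(e in edges T) hom_density (induced H (edge_cap e)) G.
Proof.
have [[treeT coverV _ _] isoJ _] := decT.
have [[/card_gt0P[r _] _] _] := treeT.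
have [k homk] := set0Pn _ homJG.
(* The averages need some map to exist. If [VH] has a vertex, its bag is a copy of [J], so [k]
   provides a vertex of [G] for a constant map. *)
have [h0] : inhabited {ffun VH -> VG}.
  have [x _|VH0] := pickP VH; last first.
    by split; apply: finfun => x; have := VH0 x.
  have : x \in \bigcup_(X in F) X by rewrite coverV.
  case/bigcupP => X XF xX; have [f _] := isoJ X XF.
  by split; apply: [ffun=> k (f (exist _ x xX))].
set N := hom_density J G.
have avgN : avg (hom_ind H G (sval r)) = N.
  by apply: avg_hom_ind_isomorphic h0 _; apply/isoJ/valP.
have N0 : 0 < N.
  by rewrite /N hom_density_avg; apply: (avg_gt0 (x := k)); rewrite ?homk.
pose w := tree_weight G H T [set: {X : {set VH} | X \in F}].
have w_ge0 h : 0 <= w h.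
  apply: mulr_ge0; apply: prodr_ge0; first by move=> Z _; apply: hom_ind_ge0.
  by move=> e _; rewrite invr_ge0 edge_ext_ge0.
have avg_w : avg (fun h => N^-1 * w h) = 1.
  rewrite avgMl -(avg_cond_avg (sval r)) (eq_avg (cond_avg_tree_weight G decT r)).
  by rewrite avgN mulVf ?gt_eqF.
have ext_pos h e :
    \prod_(Z in [set: {X : {set VH} | X \in F}]) hom_ind H G (sval Z) h != 0 ->
    e \in edges T -> 0 < edge_ext G H e h.
  move=> hH /edgesP[[X Y] /= TXY ->].
  apply: (edge_ext_gt0 decT) => //; apply: contraNT hH => hY.
  by rewrite (bigD1 Y) ?inE //= /hom_ind (negPf hY) mul0r.
have p_ge0 h : 0 <= N^-1 * w h by rewrite mulr_ge0 ?invr_ge0 // ltW.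
have weight_neq0 h : N^-1 * w h != 0 ->
    \prod_(Z in [set: {X : {set VH} | X \in F}]) hom_ind H G (sval Z) h != 0.
  by rewrite !mulf_eq0 !negb_or => /and3P[].
have := hoelder_inv p_ge0 avg_w (fun h e ph => ext_pos h e (weight_neq0 h ph)).
(* The factors [edge_ext] cancel the inverses in [w], leaving the product of the bag indicators,
   which is the indicator of a homomorphism of [H]. *)
have -> : avg (fun h => N^-1 * w h * \prod_(e in edges T) edge_ext G H e h) =
          N^-1 * hom_density H G.
  rewrite hom_density_avg -avgMl; apply: eq_avg => h; rewrite -mulrA.
  congr (_ * _); rewrite -(bags_hom G decT) /w /tree_weight edges_inT.
  set Q := \prod_(Z in [set: {X : {set VH} | X \in F}]) _.
  have [->|Q0] := eqVneq Q 0; first by rewrite !mul0r.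
  rewrite prodfV mulfVK //; apply/prodf_neq0 => e eT.
  by rewrite gt_eqF // ext_pos.
set t := hom_density H G.
set P := \prod_(e in edges T) hom_density _ _.
have t0 : 0 <= t by rewrite mulr_ge0 ?invr_ge0 ?exprn_ge0.
move=> holder.
have {holder} : 1 <= N^-1 * t * (N^-1 ^+ #|edges T| * P).
  have -> : N^-1 ^+ #|edges T| * P =
      \prod_(e in edges T) (N^-1 * hom_density (induced H (edge_cap e)) G).
    by rewrite big_split prodr_const.
  apply: le_trans holder _; apply: ler_wpM2l.
    by rewrite mulr_ge0 ?invr_ge0 ?(ltW N0).
  apply: ler_prod => e eT; apply/andP; split.
    apply: avg_ge0 => h; apply: divr_ge0 (p_ge0 h) _; exact: edge_ext_ge0.
  rewrite (eq_avg (g := fun h => N^-1 * (w h / edge_ext G H e h))); last first.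
    by move=> h; rewrite -mulrA.
  rewrite avgMl ler_wpM2l ?invr_ge0 ?(ltW N0) //.
  rewrite -(avg_hom_ind_induced _ _ _ h0); exact: (avg_tree_weight_edge G decT eT).
(* One factor [N^-1] per edge and one from the first average make up the exponent [#|F|]. *)
have cardF : #|F| = #|edges T|.+1.
  by rewrite (card_tree_edges treeT) card_sig; apply: eq_card => X; rewrite inE.
(* With [P = 0] the quotient is 0 by convention, and [t] is nonnegative. *)
have [-> _|P0] := eqVneq P 0; first by rewrite invr0 mulr0.
have Ppos : 0 < P.
  rewrite lt_def P0 prodr_ge0 // => e _.
  by rewrite mulr_ge0 ?invr_ge0 ?exprn_ge0.
rewrite ler_pdivrMr // cardF mulrACA -exprS exprVn.
by rewrite mulrC ler_pdivlMr ?exprn_gt0 // mul1r.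
Qed.
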